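(* Let $p$ be a prime and let $G$ be a non-abelian $p$-group of order $p^n$. If the derived subgroup $G'$ has order $|G'|=p^m$, then the non-abelian tensor square $G\otimes G$ satisfies \[|G\otimes G|\leq p^{(n-1)(n-m)+2}.\]
   Context: For a group $G$, write ${}^g g'=gg'g^{-1}$. The non-abelian tensor square $G\otimes G$ is the group generated by the symbols $g\otimes h$ ($g,h\in G$) subject to the relations \[gg'\otimes h=({}^g g'\otimes {}^g h)(g\otimes h),\qquad g\otimes hh'=(g\otimes h)({}^h g\otimes {}^h h')\] for all $g,g',h,h'\in G$. The derived subgroup of $G$ is denoted $G'$. *)

(* Defs.v *)
From HB Require Import structures.
From mathcomp Require Import all_boot.
From mathcomp Require Import boolp.

Set Implicit Arguments.
Unset Strict Implicit.
Unset Printing Implicit Defensive.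

Local Open Scope group_scope.
Local Open Scope quotient_scope.

(* Group presentations.  The letter (false, x) stands for the generator x and *)
(* (true, x) for its formal inverse; R u v is the defining relation u = v.    *)
Section Presentation.
Variable X : choiceType.

Definition word := seq (bool * X).

Definition inv_letter (l : bool * X) : bool * X := (~~ l.1, l.2).
Definition inv_word (w : word) : word := rev (map inv_letter w).

Variable R : word -> word -> Prop.

Inductive pres_eq : word -> word -> Prop :=
| PresRel u v : R u v -> pres_eq u v
| PresInv l : pres_eq [:: l; inv_letter l] [::]
| PresCat u u' v v' :
    pres_eq u u' -> pres_eq v v' -> pres_eq (u ++ v) (u' ++ v')
| PresRefl u : pres_eq u u
| PresSym u v : pres_eq u v -> pres_eq v u
| PresTrans u v w : pres_eq u v -> pres_eq v w -> pres_eq u w.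

Definition pres_eqb : rel word := fun u v => `[< pres_eq u v >].

Lemma pres_eqb_refl : reflexive pres_eqb.
Proof. by move=> u; apply/asboolP; exact: PresRefl. Qed.

Lemma pres_eqb_sym : symmetric pres_eqb.
Proof. by move=> u v; apply/asboolP/asboolP; exact: PresSym. Qed.

Lemma pres_eqb_trans : transitive pres_eqb.
Proof.
by move=> v u w /asboolP uv /asboolP vw; apply/asboolP; exact: PresTrans uv vw.
Qed.

Canonical pres_equiv :=
  EquivRel pres_eqb pres_eqb_refl pres_eqb_sym pres_eqb_trans.

Definition presented := {eq_quot pres_equiv}.

HB.instance Definition _ := Choice.on presented.
HB.instance Definition _ := EqQuotient.on presented.

Definition pres_class (w : word) : presented := \pi_presented w.

Lemma pres_classP u v : pres_class u = pres_class v <-> pres_eq u v.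
Proof. by split=> [/eqmodP/asboolP|uv] //; apply/eqmodP/asboolP. Qed.

Lemma inv_letterK : involutive inv_letter.
Proof. by case=> b x; rewrite /inv_letter /= negbK. Qed.

Lemma inv_wordK : involutive inv_word.
Proof.
move=> w; rewrite /inv_word map_rev revK -map_comp.
by rewrite (eq_map (g := id)) ?map_id // => l; exact: inv_letterK.
Qed.

Lemma pres_eq_mulwV w : pres_eq (w ++ inv_word w) [::].
Proof.
elim: w => [|l w IHw] /=; first exact: PresRefl.
rewrite /inv_word /= rev_cons -cats1 -/(inv_word w) catA.
apply: PresTrans (PresInv l).
apply: (PresCat (u := [:: l]) (u' := [:: l])) (PresRefl _) _.
exact: (PresCat (u' := [::]) IHw (PresRefl _)).
Qed.

Lemma pres_eq_mulVw w : pres_eq (inv_word w ++ w) [::].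
Proof. by have := pres_eq_mulwV (inv_word w); rewrite inv_wordK. Qed.

Lemma pres_eq_inv u v : pres_eq u v -> pres_eq (inv_word u) (inv_word v).
Proof.
move=> uv; apply: (@PresTrans _ (inv_word u ++ (v ++ inv_word v))).
  rewrite -[X in pres_eq X _]cats0; apply: PresCat (PresRefl _) _.
  exact: PresSym (pres_eq_mulwV v).
rewrite catA -[X in pres_eq _ X]cat0s; apply: PresCat (PresRefl _).
apply: PresTrans (pres_eq_mulVw u).
exact: PresCat (PresRefl _) (PresSym uv).
Qed.

Definition pres_one : presented := pres_class [::].
Definition pres_mul (a b : presented) : presented :=
  pres_class (repr a ++ repr b).
Definition pres_inv (a : presented) : presented :=
  pres_class (inv_word (repr a)).

Lemma pres_mulE u v :
  pres_mul (pres_class u) (pres_class v) = pres_class (u ++ v).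
Proof. by apply/pres_classP/PresCat; apply/pres_classP; exact: reprK. Qed.

Lemma pres_invE u : pres_inv (pres_class u) = pres_class (inv_word u).
Proof. by apply/pres_classP/pres_eq_inv; apply/pres_classP; exact: reprK. Qed.

Lemma pres_class_surj (a : presented) : a = pres_class (repr a).
Proof. by rewrite /pres_class reprK. Qed.

Lemma pres_mulA : associative pres_mul.
Proof.
move=> a b c; rewrite [a]pres_class_surj [b]pres_class_surj.
by rewrite [c]pres_class_surj !pres_mulE catA.
Qed.

Lemma pres_mul1 : left_id pres_one pres_mul.
Proof. by move=> a; rewrite [a]pres_class_surj pres_mulE. Qed.

Lemma pres_mulr1 : right_id pres_one pres_mul.
Proof. by move=> a; rewrite [a]pres_class_surj pres_mulE cats0. Qed.

Lemma pres_mulV : left_inverse pres_one pres_inv pres_mul.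
Proof.
move=> a; rewrite [a]pres_class_surj pres_invE pres_mulE.
exact/pres_classP/pres_eq_mulVw.
Qed.

Lemma pres_mulrV : right_inverse pres_one pres_inv pres_mul.
Proof.
move=> a; rewrite [a]pres_class_surj pres_invE pres_mulE.
exact/pres_classP/pres_eq_mulwV.
Qed.

HB.instance Definition _ := isGroup.Build presented
  pres_mulA pres_mul1 pres_mulr1 pres_mulV pres_mulrV.

Definition pres_gen (x : X) : presented := pres_class [:: (false, x)].

Definition eval_letter (H : groupType) (f : X -> H) (l : bool * X) : H :=
  if l.1 then (f l.2)^-1 else f l.2.
Definition eval_word (H : groupType) (f : X -> H) (w : word) : H :=
  \prod_(l <- w) eval_letter f l.

Lemma pres_eq_eval (H : groupType) (f : X -> H) :
    (forall u v, R u v -> eval_word f u = eval_word f v) ->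
  forall u v, pres_eq u v -> eval_word f u = eval_word f v.
Proof.
move=> fR u v; elim=> {u v} [u v /fR //|[b x]|u u' v v' _ Eu _ Ev|//|//|u v w].
- rewrite /eval_word big_cons big_seq1 big_nil /eval_letter /=.
  by case: b; rewrite ?mulVg ?mulgV.
- by rewrite /eval_word !big_cat /= -/(eval_word f u) -/(eval_word f v) Eu Ev.
- by move=> _ -> _ ->.
Qed.

Lemma pres_class_eval (w : word) : pres_class w = eval_word pres_gen w.
Proof.
elim: w => [|[b x] w IHw]; first by rewrite /eval_word big_nil.
rewrite /eval_word big_cons -/(eval_word pres_gen w) -IHw.
have -> : eval_letter pres_gen (b, x) = pres_class [:: (b, x)].
  by case: b => //; exact: pres_invE.
by rewrite [RHS]pres_mulE.
Qed.

Theorem presented_universal (H : groupType) (f : X -> H) :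
    (forall u v, R u v -> eval_word f u = eval_word f v) ->
  exists! phi : presented -> H,
    {morph phi : a b / a * b} /\ forall x, phi (pres_gen x) = f x.
Proof.
move=> fR; pose phi (a : presented) := eval_word f (repr a).
have phiE w : phi (pres_class w) = eval_word f w.
  by apply: pres_eq_eval fR _ _ _; apply/pres_classP; exact: reprK.
exists phi; split=> [|psi [psiM psiX]].
  split=> [a b|x]; last by rewrite phiE /eval_word big_seq1.
  by rewrite [a * b]/(pres_mul a b) phiE /eval_word big_cat.
have psi1 : psi 1 = 1 by apply: (mulgI (psi 1)); rewrite -psiM !mulg1.
have psiV a : psi a^-1 = (psi a)^-1.
  by apply: (mulgI (psi a)); rewrite -psiM !mulgV.
apply/funext => a; rewrite [a]pres_class_surj phiE pres_class_eval.
elim: (repr a) => [|[b x] w IHw]; first by rewrite /eval_word !big_nil psi1.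
rewrite /eval_word !big_cons -!/(eval_word _ w) psiM IHw; congr (_ * _).
by rewrite /eval_letter /=; case: b; rewrite ?psiV psiX.
Qed.

End Presentation.

Section TensorSquare.
Variable G : groupType.
Implicit Types g h : G.

(* Mathcomp's g' ^ g is g^-1 * g' * g; the tensor square uses left            *)
(* conjugation instead.                                                       *)
Definition lconj g g' : G := g * g' * g^-1.

Let sym g h : bool * (G * G) := (false, (g, h)).

Inductive tensor_rel : word (G * G)%type -> word (G * G)%type -> Prop :=
| TensorMull g g' h :
    tensor_rel [:: sym (g * g') h] [:: sym (lconj g g') (lconj g h); sym g h]
| TensorMulr g h h' :
    tensor_rel [:: sym g (h * h')] [:: sym g h; sym (lconj h g) (lconj h h')].

Definition tensor_square := presented tensor_rel.
HB.instance Definition _ := Group.on tensor_square.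

Definition tensor g h : tensor_square := pres_gen tensor_rel (g, h).

Lemma tensorMl g g' h :
  tensor (g * g') h = tensor (lconj g g') (lconj g h) * tensor g h.
Proof.
rewrite [RHS]pres_mulE /=.
exact/pres_classP/PresRel/TensorMull.
Qed.

Lemma tensorMr g h h' :
  tensor g (h * h') = tensor g h * tensor (lconj h g) (lconj h h').
Proof.
rewrite [RHS]pres_mulE /=.
exact/pres_classP/PresRel/TensorMulr.
Qed.

End TensorSquare.

(* Main.v *)
Require Import Defs.
From mathcomp Require Import all_boot all_fingroup all_solvable.
From mathcomp Require Import classical_sets cardinality.

(** Write T(G) for the tensor square and z for a central commutator [x, y] of
    order p, which every non-abelian p-group has.  The theorem is proved by
    induction on the order of G', passing from G to the quotient Q = G / <z>.

    The elements of T(G) are lifts of elements of T(Q) up to a factor in the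
    subgroup generated by all z (x) g and all g (x) z, so the point is that
    this subgroup is small.  As z is central, g |-> z (x) g is a homomorphism
    into the centre of T(G) ([tensor_zM]).  As z is a commutator, g (x) z is
    the inverse of z (x) g ([tensor_commutatorC]), so the subgroup is just the
    set of all z (x) g, and if the homomorphism is trivial on a subgroup K then
    |T(G)| <= |T(Q)| |G : K| ([at_most_central_extension]).

    Two choices of K are used.  It may be G', because the homomorphism has a
    commutative image; then |G : K| = p^(n - m).  It may also be the set of
    elements commuting with x and y, because the element
    z (x) g = (gx (x) gy)^-1 (x (x) y), where gx and gy denote conjugates by g,
    measures how g moves x (x) y.  A conjugacy class is no larger than
    G', so that this K has index at most p^2 when |G'| = p.

    For |G'| = p the quotient Q is abelian of order p^(n - 1) with at most
    n - 1 generators, so T(Q) has order at most p^((n - 1)^2) by bilinearity,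
    and the second K contributes the factor p^2.  For larger G' the first K
    contributes p^(n - m), which is what raises the bound
    p^((n - 2)(n - m) + 2) for Q to p^((n - 1)(n - m) + 2). *)
Set Implicit Arguments.
Unset Strict Implicit.
Unset Printing Implicit Defensive.

#[local] Arguments lconj : simpl never.

(** * Tensor calculus *)

Section Calculus.
Local Open Scope group_scope.
Variable G : groupType.
Implicit Types g h x y z : G.
Local Notation "g \ox h" := (tensor g h) (at level 35).

Definition central z := forall g, commute z g.

Lemma lconj1g g : lconj 1 g = g.
Proof. by rewrite /lconj mul1g invg1 mulg1. Qed.

Lemma lconjM g h x : lconj (g * h) x = lconj g (lconj h x).
Proof. by rewrite /lconj invgM !mulgA. Qed.

Lemma lconj_commute g x : commute g x -> lconj g x = x.
Proof. by move=> gx; rewrite /lconj gx mulgK. Qed.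

Lemma lconj_mul g x : lconj g x * g = g * x.
Proof. by rewrite /lconj mulgKV. Qed.

Lemma lconjMr g x y : lconj g (x * y) = lconj g x * lconj g y.
Proof. by rewrite /lconj !mulgA mulgKV. Qed.

Lemma lconjK g x : lconj g (lconj g^-1 x) = x.
Proof. by rewrite -lconjM mulgV lconj1g. Qed.

Lemma tensor1g g : 1 \ox g = 1.
Proof.
have := tensorMl 1 1 g; rewrite !lconj1g mulg1 => /(canLR (mulKg _)).
by rewrite mulVg.
Qed.

Lemma tensorg1 g : g \ox 1 = 1.
Proof.
have := tensorMr g 1 1; rewrite !lconj1g mulg1 => /(canLR (mulKg _)).
by rewrite mulVg.
Qed.

(** Expanding gx (x) hy from the left and from the right gives two products that
    differ only in their two middle factors.  This is the identity that makes
    conjugation by g (x) h the action of the commutator of g and h. *)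
Lemma tensor_swap g h x y :
  (lconj (g * h) x \ox lconj (g * h) y) * (g \ox h) =
  (g \ox h) * (lconj (h * g) x \ox lconj (h * g) y).
Proof.
have EL : (g * x) \ox (h * y) =
    (lconj g x \ox lconj g h) * ((lconj (g * h) x \ox lconj (g * h) y)
      * (g \ox h)) * (lconj h g \ox lconj h y).
  rewrite (tensorMl g x (h * y)) lconjMr (tensorMr g h y).
  rewrite (tensorMr (lconj g x) (lconj g h) (lconj g y)) -!lconjM !lconj_mul.
  by rewrite !mulgA.
have ER : (g * x) \ox (h * y) =
    (lconj g x \ox lconj g h) * ((g \ox h)
      * (lconj (h * g) x \ox lconj (h * g) y)) * (lconj h g \ox lconj h y).
  rewrite (tensorMr (g * x) h y) lconjMr (tensorMl g x h).
  rewrite (tensorMl (lconj h g) (lconj h x) (lconj h y)) -!lconjM !lconj_mul.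
  by rewrite !mulgA.
by move: EL; rewrite ER => /mulIg/mulgI.
Qed.

Lemma tensor_ind (P : tensor_square G -> Prop) :
    P 1 -> (forall g h t, P t -> P ((g \ox h) * t)) ->
    (forall g h t, P t -> P ((g \ox h)^-1 * t)) -> forall t, P t.
Proof.
move=> P1 Pm Pv t; rewrite [t]pres_class_surj pres_class_eval.
elim: (generic_quotient.repr t) => [|[b [g h]] w IHw].
  by rewrite /eval_word big_nil.
rewrite /eval_word big_cons /eval_letter.
by case: b => /=; [exact: Pv | exact: Pm].
Qed.

(** The hypothesis says that the commutator of g and h is central, so that by
    [tensor_swap] the generator g (x) h acts trivially on all others. *)
Lemma tensor_central g h :
    (forall x, lconj (g * h) x = lconj (h * g) x) ->
  forall t, commute (g \ox h) t.
Proof.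
move=> gh; have gen x y : commute (g \ox h) (x \ox y).
  rewrite /commute -[x](lconjK (h * g)) -[y](lconjK (h * g)).
  by rewrite -tensor_swap !gh.
elim/tensor_ind => [|x y t|x y t]; first exact: commute1.
  by apply: commuteM.
by apply: commuteM; apply: commuteV.
Qed.

Lemma tensor_commute g h : commute g h -> forall t, commute (g \ox h) t.
Proof. by move=> gh; apply: tensor_central => x; rewrite gh. Qed.

Section CentralCommutator.
Variables x y : G.
Let c := x * y * x^-1 * y^-1.
Hypothesis cC : central c.

Let xyE : x * y = c * (y * x).
Proof. by rewrite /c !mulgA !mulgKV. Qed.

Let conj_c g : lconj c g = g.
Proof. exact/lconj_commute/cC. Qed.

Lemma tensor_commutator_central t : commute (x \ox y) t.
Proof. by apply: tensor_central => g; rewrite xyE lconjM conj_c. Qed.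

(** The case of a central commutator c = [x, y] of the general fact that
    [x, y] (x) g is the quotient of x (x) y by its conjugate under g. *)
Lemma tensor_commutatorl g :
  c \ox g = (lconj g x \ox lconj g y)^-1 * (x \ox y).
Proof.
have xE : x = c * lconj y x by rewrite /lconj /c !mulgA !mulgKV mulgK.
have E1 : x \ox g = (lconj y x \ox g) * (c \ox g).
  by rewrite {1}xE tensorMl !conj_c.
(* Both sides are the expansion of x (x) gy, where gy = y(y^-1gy). *)
have E2 : (x \ox y) * (lconj y x \ox g)
         = (x \ox g) * (lconj g x \ox lconj g y).
  rewrite -tensorMr -{1}[g](lconjK y) -tensorMr.
  by rewrite /lconj invgK !mulgA mulgV mul1g.
have TC : commute (x \ox y) (x \ox g) by exact: tensor_commutator_central.
have {}E2 : lconj y x \ox g =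
    (x \ox y)^-1 * ((x \ox g) * (lconj g x \ox lconj g y)).
  by rewrite -E2 mulKg.
have -> : c \ox g = (lconj y x \ox g)^-1 * (x \ox g) by rewrite E1 mulKg.
by rewrite E2 !invgM invgK -!mulgA TC mulKg.
Qed.

Lemma tensor_commutatorr g :
  g \ox c = (lconj g x \ox lconj g y) * (x \ox y)^-1.
Proof.
have E1 : g \ox lconj x y = (g \ox c) * (g \ox y).
  have -> : lconj x y = c * y by rewrite /lconj /c !mulgKV.
  by rewrite tensorMr !conj_c.
(* Both sides are the expansion of gx (x) y, where gx = x(x^-1gx). *)
have E2 : (g \ox lconj x y) * (x \ox y)
         = (lconj g x \ox lconj g y) * (g \ox y).
  rewrite -[g in LHS](lconjK x) -tensorMl -tensorMl.
  by congr tensor; rewrite /lconj invgK !mulgA mulgV mul1g.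
have TC : commute (x \ox y) (g \ox y) by exact: tensor_commutator_central.
apply: (mulIg (g \ox y)); rewrite -E1.
apply: (mulIg (x \ox y)); rewrite E2 -!mulgA; congr (_ * _).
by rewrite -TC mulKg.
Qed.

Lemma tensor_commutatorC g : g \ox c = (c \ox g)^-1.
Proof.
rewrite tensor_commutatorl tensor_commutatorr invgM invgK.
exact/commuteV/commute_sym/tensor_commutator_central.
Qed.

Lemma tensor_commutator_centraliser g :
  commute g x -> commute g y -> c \ox g = 1.
Proof. by move=> gx gy; rewrite tensor_commutatorl !lconj_commute ?mulVg. Qed.

End CentralCommutator.

Section CentralElement.
Variable z : G.
Hypothesis zC : central z.

Let conjz g : lconj z g = g. Proof. exact/lconj_commute/zC. Qed.
Let conjgz g : lconj g z = z.
Proof. by apply/lconj_commute/commute_sym/zC. Qed.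

Lemma tensor_zC g t : commute (z \ox g) t.
Proof. exact/tensor_commute/zC. Qed.

Lemma tensor_zMl g h : (z * g) \ox h = (g \ox h) * (z \ox h).
Proof. by rewrite tensorMl !conjz. Qed.

Lemma tensor_zMr g h : g \ox (z * h) = (g \ox z) * (g \ox h).
Proof. by rewrite tensorMr !conjz. Qed.

(** Conjugation by h fixes z, so the second relation turns into bilinearity in
    the second variable, with factors that commute. *)
Lemma tensor_zM g h : z \ox (g * h) = (z \ox g) * (z \ox h).
Proof.
have -> : g * h = h * lconj h^-1 g by rewrite -(lconj_mul h) lconjK.
by rewrite tensorMr !conjgz lconjK tensor_zC.
Qed.

End CentralElement.
End Calculus.

Lemma tensor_central_der1 (gT : finGroupType) (z : gT) : central z ->
  {in ([set: gT]^`(1))%g, forall g, tensor z g = 1%g}.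
Proof.
move=> zC g; rewrite derg1 => /gen_prodgP[n [c cG ->]].
elim/big_ind: _ => [|x y zx zy|i _]; first exact: tensorg1.
  by rewrite tensor_zM // zx zy mulg1.
have /imset2P[x y _ _ ->] := cG i.
rewrite commgEl conjgE !tensor_zM // (tensor_zC zC y^-1 _).
by rewrite -!tensor_zM // mulgK mulVg tensorg1.
Qed.

Lemma tensor_central_commutator (gT : finGroupType) (x y : gT) :
    central [~ x, y]%g ->
  (forall g, tensor g [~ x, y]%g = ((tensor [~ x, y] g)^-1)%g) /\
  (forall g, commute g x -> commute g y -> tensor [~ x, y]%g g = 1%g).
Proof.
(* The convention for commutators here is x^-1y^-1xy. *)
have -> : [~ x, y]%g = (x^-1 * y^-1 * x^-1^-1 * y^-1^-1)%g.
  by rewrite !invgK commgEl conjgE !mulgA.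
move=> zC; split=> g; first exact: tensor_commutatorC.
by move=> gx gy; apply: tensor_commutator_centraliser => //; apply: commuteV.
Qed.

(** * Bounding the tensor square by that of a central quotient *)

(** A bound on the size of a type that is not known to be finite.  Lists keep
    the products of bounds elementary. *)
Definition at_most (T : eqType) k :=
  exists2 s : seq T, size s <= k & forall x, x \in s.

Lemma at_mostW (T : eqType) k l : k <= l -> at_most T k -> at_most T l.
Proof. by move=> kl [s sk sP]; exists s => //; apply: leq_trans kl. Qed.

Section CentralExtension.
Local Open Scope group_scope.
Variables (gT : finGroupType) (z : gT).
Local Notation "g \ox h" := (tensor g h) (at level 35).
Hypothesis zC : central z.
Hypothesis zsym : forall g, g \ox z = (z \ox g)^-1.

Local Notation Z := <[z]>.
Local Notation Q := (coset_of Z).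

(** Equality up to a factor z (x) g, that is, in T(G) modulo the image of the
    homomorphism g |-> z (x) g. *)
Definition congz (a b : tensor_square gT) := exists g, a = b * (z \ox g).

Lemma tensorzV g : z \ox g^-1 = (z \ox g)^-1.
Proof. by apply: (mulgI (z \ox g)); rewrite -tensor_zM // !mulgV tensorg1. Qed.

Lemma tensorzX g i : z \ox (g ^+ i) = (z \ox g) ^+ i.
Proof.
by elim: i => [|i IHi]; rewrite ?expg0 ?tensorg1 // !expgS tensor_zM // IHi.
Qed.

Lemma tensorXz g i : (z ^+ i) \ox g = (z \ox g) ^+ i.
Proof.
elim: i => [|i IHi]; last by rewrite !expgS tensor_zMl // IHi tensor_zC.
by rewrite tensor1g.
Qed.

Lemma tensorzrX g i : g \ox (z ^+ i) = (z \ox g) ^- i.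
Proof.
elim: i => [|i IHi]; first by rewrite tensorg1 invg1.
by rewrite expgS tensor_zMr // IHi zsym -invgM -expgSr.
Qed.

Lemma congz_refl a : congz a a.
Proof. by exists 1; rewrite tensorg1 mulg1. Qed.

Lemma congz_sym a b : congz a b -> congz b a.
Proof. by case=> g ->; exists g^-1; rewrite tensorzV mulgK. Qed.

Lemma congz_trans a b c : congz a b -> congz b c -> congz a c.
Proof.
by case=> g -> [h ->]; exists (h * g); rewrite tensor_zM // mulgA.
Qed.

Lemma congzM a a' b b' : congz a a' -> congz b b' -> congz (a * b) (a' * b').
Proof.
case=> g -> [h ->]; exists (g * h).
by rewrite tensor_zM // !mulgA -(mulgA a') (tensor_zC zC) !mulgA.
Qed.

Lemma congzV a b : congz a b -> congz a^-1 b^-1.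
Proof.
case=> g ->; exists g^-1; rewrite invgM -tensorzV.
exact: tensor_zC.
Qed.

Lemma norm_cycle_central x : x \in 'N(Z).
Proof.
apply: (fintype.subsetP (cent_sub _)).
by rewrite cent_cycle; apply/cent1P/commute_sym/zC.
Qed.

Lemma cosetzM x y : coset Z (x * y) = coset Z x * coset Z y.
Proof. by rewrite morphM ?norm_cycle_central. Qed.

Lemma cosetz_lconj x y : coset Z (lconj x y) = lconj (coset Z x) (coset Z y).
Proof. by rewrite /lconj !cosetzM morphV ?norm_cycle_central. Qed.

Lemma congz_tensor g g' h h' :
  coset Z g = coset Z g' -> coset Z h = coset Z h' ->
  congz (g \ox h) (g' \ox h').
Proof.
move=> /rcoset_kercosetP-/(_ (norm_cycle_central _) (norm_cycle_central _)).
case/rcosetP=> _ /cycleP[i ->] ->.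
move=> /rcoset_kercosetP-/(_ (norm_cycle_central _) (norm_cycle_central _)).
case/rcosetP=> _ /cycleP[j ->] ->.
have ziC k : central (z ^+ k).
  by move=> x; apply/commute_sym/commuteX/commute_sym/zC.
apply: congz_trans (_ : congz (g' \ox (z ^+ j * h')) _).
  exists ((z ^+ j * h') ^+ i).
  by rewrite tensor_zMl // tensorXz tensorzX.
exists (g' ^- j); rewrite tensor_zMr // tensorzrX -tensorzX -tensorzV.
exact: tensor_zC.
Qed.

(** A name for [repr] at the type of cosets, which [simpl] does not unfold. *)
Definition coset_rep (q : Q) : gT := repr q.

Lemma coset_repK q : coset Z (coset_rep q) = q.
Proof. exact: coset_reprK. Qed.

(** The lift is defined on words, since only up to [congz] does it respect the
    relations of T(Q). *)
Definition tensor_lift (w : word (Q * Q)%type) : tensor_square gT :=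
  eval_word (fun q : (Q * Q)%type => coset_rep q.1 \ox coset_rep q.2) w.

Lemma tensor_lift_cat u v :
  tensor_lift (u ++ v) = tensor_lift u * tensor_lift v.
Proof. by rewrite /tensor_lift /eval_word big_cat. Qed.

Lemma congz_lift u v :
  pres_eq (@tensor_rel Q) u v -> congz (tensor_lift u) (tensor_lift v).
Proof.
elim=> {u v}
  [u v [g g' h|g h h']|[b q]|u u' v v' _ Eu _ Ev|u|u v _|u v w _ uv _].
- rewrite /tensor_lift /eval_word !big_cons !big_nil /eval_letter /= !mulg1.
  apply: congz_trans
    (_ : congz ((coset_rep g * coset_rep g') \ox coset_rep h) _).
    by apply: congz_tensor => //; rewrite cosetzM !coset_repK.
  rewrite tensorMl; apply: congzM (congz_refl _).
  by apply: congz_tensor; rewrite cosetz_lconj !coset_repK.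
- rewrite /tensor_lift /eval_word !big_cons !big_nil /eval_letter /= !mulg1.
  apply: congz_trans
    (_ : congz (coset_rep g \ox (coset_rep h * coset_rep h')) _).
    by apply: congz_tensor => //; rewrite cosetzM !coset_repK.
  rewrite tensorMr; apply: congzM (congz_refl _) _.
  by apply: congz_tensor; rewrite cosetz_lconj !coset_repK.
- rewrite /tensor_lift /eval_word !big_cons !big_nil /eval_letter /= !mulg1.
  by case: b => /=; rewrite ?mulgV ?mulVg; apply: congz_refl.
- by rewrite !tensor_lift_cat; apply: congzM.
- exact: congz_refl.
- exact: congz_sym.
- exact: congz_trans.
Qed.

Lemma congz_lift_surj t : exists w, congz t (tensor_lift w).
Proof.
have lift1 b g h : congz (eval_letter (fun q => q.1 \ox q.2) (b, (g, h)))
    (tensor_lift [:: (b, (coset Z g, coset Z h))]).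
  have gh : congz (g \ox h) (coset_rep (coset Z g) \ox coset_rep (coset Z h)).
    by apply: congz_tensor; rewrite coset_repK.
  rewrite /tensor_lift /eval_word big_seq1 /eval_letter /=.
  by case: b => //; apply: congzV.
elim/tensor_ind: t => [|g h t [w tw]|g h t [w tw]].
- by exists [::]; rewrite /tensor_lift /eval_word big_nil; apply: congz_refl.
- exists ((false, (coset Z g, coset Z h)) :: w).
  by rewrite -cat1s tensor_lift_cat; apply: congzM tw; apply: (lift1 false).
- exists ((true, (coset Z g, coset Z h)) :: w).
  by rewrite -cat1s tensor_lift_cat; apply: congzM tw; apply: (lift1 true).
Qed.

(** Every t in T(G) is c' * (z (x) g), where c' lifts some c in T(Q) and z (x) g
    depends only on the coset of g modulo K. *)
Lemma at_most_central_extension (K : {group gT}) k :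
    {in K, forall g, z \ox g = 1} -> at_most (tensor_square Q) k ->
  at_most (tensor_square gT) (k * #|[set: gT] : K|).
Proof.
move=> Kz [s sk sP].
pose f (c : tensor_square Q) (C : {set gT}) :=
  tensor_lift (generic_quotient.repr c) * (z \ox repr C).
exists [seq f c C | c <- s, C <- enum (rcosets K [set: gT])].
  by rewrite size_allpairs -cardE leq_mul2r sk orbT.
move=> t; have [w tw] := congz_lift_surj t.
pose c : tensor_square Q := pres_class (@tensor_rel Q) w.
have [g ->]: congz t (tensor_lift (generic_quotient.repr c)).
  apply: congz_trans tw _; apply: congz_lift.
  by apply/pres_classP; rewrite -pres_class_surj.
have -> : z \ox g = z \ox repr (K :* g).
  have /rcosetP[x xK ->] := mem_repr_rcoset K g.
  by rewrite tensor_zM // (Kz x xK) mul1g.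
apply: (allpairs_f f); first exact: sP.
by rewrite mem_enum; apply/rcosetsP; exists g.
Qed.

End CentralExtension.

(** * Abelian groups *)

Section AbelianTensor.
Local Open Scope group_scope.
Variable A : finGroupType.
Hypothesis cAA : abelian [set: A].
Local Notation "g \ox h" := (tensor g h) (at level 35).

Let cA (a : A) : central a.
Proof. by move=> b; apply: (centsP cAA); rewrite inE. Qed.

(** The list consists of all products of elements a_b (x) b, one for each b in
    s; by bilinearity such products are closed under multiplication. *)
Lemma abelian_tensor_list (s : seq A) :
  exists l : seq (tensor_square A), [/\ (size l <= #|A| ^ size s)%N, 1 \in l,
    {in l &, forall t u, t * u \in l}
    & forall a b, b \in s -> a \ox b \in l].
Proof.
elim: s => [|b s [l [sl l1 lM lS]]].
  exists [:: 1]; split=> [||t u|//]; rewrite ?inE //.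
  by move=> /eqP-> /eqP->; rewrite mulg1.
pose f t a := t * (a \ox b).
exists [seq f t a | t <- l, a <- enum A]; split.
- by rewrite size_allpairs -cardE expnSr leq_mul2r sl orbT.
- have -> : 1 = f 1 1 by rewrite /f tensor1g mulg1.
  by apply: (allpairs_f f); rewrite ?mem_enum.
- move=> _ _ /allpairsP[[t a] /= [tl _ ->]] /allpairsP[[u c] /= [ul _ ->]].
  have -> : f t a * f u c = f (t * u) (c * a).
    rewrite /f tensor_zMl // -!mulgA; congr (_ * _).
    by rewrite !mulgA; congr (_ * _); apply: tensor_zC.
  by apply: (allpairs_f f); rewrite ?mem_enum ?lM.
- move=> a c; rewrite inE => /predU1P[->|cs].
    have -> : a \ox b = f 1 a by rewrite /f mul1g.
    by apply: (allpairs_f f); rewrite ?mem_enum.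
  have -> : a \ox c = f (a \ox c) 1 by rewrite /f tensor1g mulg1.
  by apply: (allpairs_f f); rewrite ?mem_enum ?lS.
Qed.

Lemma at_most_abelian_tensor :
  at_most (tensor_square A) (#|A| ^ 'm([set: A]))%N.
Proof.
have [B genB cardB] := grank_witness [set: A].
have [l [sl l1 lM lB]] := abelian_tensor_list (enum B).
exists l => [|t]; first by rewrite -cardB cardE.
have lgen a b : a \ox b \in l.
  have: b \in <<B>> by rewrite genB inE.
  case/gen_prodgP=> n [c cB ->].
  elim/big_ind: _ => [|x y xl yl|i _]; first by rewrite tensorg1.
    by rewrite tensor_zM // lM.
  by apply: lB; rewrite mem_enum.
elim/tensor_ind: t => [//|g h t tl|g h t tl]; first exact: lM.
apply: lM tl; suff -> : (g \ox h)^-1 = g^-1 \ox h by [].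
by apply: (mulgI (g \ox h)); rewrite -tensor_zMl // mulVg tensor1g mulgV.
Qed.

End AbelianTensor.

(** * Commutators in finite groups *)

Section Commutators.
Local Open Scope group_scope.
Variables (gT : finGroupType) (p : nat).
Local Notation G := [set: gT].
Hypothesis pG : p.-group G.

(** Some x outside the centre of G is central modulo it, as the centre of
    G / Z(G) is non-trivial.  Then all [x, y] are central, [x^i, y] = [x, y]^i,
    and a suitable power of x makes the order p. *)
Lemma exists_central_commutator : ~~ abelian G ->
  exists x y : gT, central [~ x, y] /\ #[[~ x, y]] = p.
Proof.
move=> nabG; have nilG : nilpotent G := pgroup_nil pG.
have nZ x : x \in 'N('Z(G)).
  by apply: (fintype.subsetP (normal_norm (center_normal _))); rewrite inE.
have: 'Z(G / 'Z(G)) != 1.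
  rewrite center_nil_eq1 ?quotient_nil //; apply: contra nabG => /eqP GZ1.
  apply/center_idP/setP=> x; rewrite [RHS]inE.
  apply/coset_idr=> //; apply/set1P.
  suff: coset 'Z(G) x \in G / 'Z(G) by rewrite GZ1.
  by apply: mem_quotient; rewrite inE.
case/trivgPn=> _ /centerP[/morphimP[x _ _ ->] xZ] nx1.
have commZ y : [~ x, y] \in 'Z(G).
  apply: coset_idr => //; rewrite morphR //; apply/eqP/commgP/xZ.
  by apply: mem_quotient; rewrite inE.
have centralZ z : z \in 'Z(G) -> central z.
  by move=> /centerP[_ zG] g; apply: zG; rewrite inE.
have [y nxy] : exists y, [~ x, y] != 1.
  apply/existsP; apply: contraR nx1 => /existsPn xy1.
  apply/eqP/coset_id/centerP; split=> [|y _]; first by rewrite inE.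
  by apply/commgP; have:= xy1 y; rewrite negbK.
pose q := (#[[~ x, y]] %/ p)%N.
have pq : (#[[~ x, y]] = q * p)%N.
  rewrite divnK //; have [|k def_o] := p_natP (mem_p_elt pG (x := [~ x, y]) _).
    by rewrite inE.
  move: nxy; rewrite -order_eq1 def_o; case: k {def_o} => // k _.
  by rewrite expnS dvdn_mulr.
have zE : [~ x ^+ q, y] = [~ x, y] ^+ q.
  exact/commXg/commute_sym/centralZ.
exists (x ^+ q), y; rewrite zE; split.
  by apply: centralZ; rewrite groupX.
rewrite orderXdiv ?pq ?dvdn_mulr // mulKn //.
by have := order_gt0 [~ x, y]; rewrite pq muln_gt0 => /andP[].
Qed.

(** The conjugates of x lie in the coset xG'. *)
Lemma index_cent1_der1 (x : gT) : #|G : 'C_G[x]| <= #|G^`(1)|.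
Proof.
rewrite index_cent1 -(card_lcoset _ x); apply/subset_leq_card/fintype.subsetP.
move=> _ /imsetP[g _ ->]; rewrite mem_lcoset -commgEl.
by apply: mem_commg; rewrite inE.
Qed.

Lemma leq_indexI (H K : {group gT}) :
  #|G : H :&: K| <= #|G : H| * #|G : K|.
Proof.
rewrite -(Lagrange_index (finset.subsetT H) (finset.subsetIl H K)).
rewrite leq_mul2l; apply/orP; right.
rewrite -(leq_pmul2l (cardG_gt0 (H :&: K))) Lagrange ?finset.subsetIl //.
rewrite -(leq_pmul2l (cardG_gt0 K)) mul_cardG finset.setIC mulnCA.
rewrite Lagrange ?finset.subsetT // mulnC leq_mul2l orbC.
by rewrite subset_leq_card ?finset.subsetT.
Qed.

End Commutators.

(** * The bound for non-abelian p-groups *)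

Section Induction.
Local Open Scope group_scope.
Variable p : nat.
Hypothesis p_pr : prime p.

Let p_gt0 : 0 < p := prime_gt0 p_pr.
Let p_gt1 : 1 < p := prime_gt1 p_pr.

Lemma exists_central_commutator_quotient n m (gT : finGroupType) :
    p.-group [set: gT] -> #|[set: gT]| = (p ^ n.+1)%N ->
    #|[set: gT]^`(1)| = (p ^ m.+1)%N ->
  exists x y : gT, let Q := [set: coset_of <[[~ x, y]]>] in
  [/\ central [~ x, y], p.-group Q, #|Q| = (p ^ n)%N
    & #|Q^`(1)| = (p ^ m)%N].
Proof.
move=> pG oG oG'.
have nabG : ~~ abelian [set: gT].
  apply: contraL p_gt1 => /derG1P G'1.
  have: p %| #|[set: gT]^`(1)| by rewrite oG' expnS dvdn_mulr.
  by rewrite G'1 cards1 dvdn1 => /eqP->.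
have [x [y [zC oz]]] := exists_central_commutator pG nabG.
have zG' : <[[~ x, y]]> \subset [set: gT]^`(1).
  by rewrite cycle_subG; apply: mem_commg; rewrite inE.
have nZ : [set: gT] \subset 'N(<[[~ x, y]]>).
  by apply/fintype.subsetP=> g _; apply: norm_cycle_central.
have nZ' := fintype.subset_trans (der_sub 1 _) nZ.
exists x, y; rewrite /= -quotientT -quotient_der //.
split=> //; first exact: quotient_pgroup.
  apply/eqP; rewrite card_quotient // -(eqn_pmul2l p_gt0) -expnS -oG.
  by rewrite -{1}oz orderE Lagrange ?finset.subsetT.
apply/eqP; rewrite card_quotient // -(eqn_pmul2l p_gt0) -expnS -oG'.
by rewrite -{1}oz orderE Lagrange.
Qed.

Lemma at_most_tensor_square n m (gT : finGroupType) :
    p.-group [set: gT] -> #|[set: gT]| = (p ^ n.+1)%N ->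
    #|[set: gT]^`(1)| = (p ^ m.+1)%N ->
  at_most (tensor_square gT) (p ^ (n * (n - m) + 2)).
Proof.
elim: m n gT => [|m IHm] n gT pG oG oG';
  have [x [y [zC pQ oQ oQ']]] := exists_central_commutator_quotient pG oG oG';
  have [zsym zcent] := tensor_central_commutator zC.
- have abQ : abelian [set: coset_of <[[~ x, y]]>].
    exact/derG1P/card1_trivg.
  have rQ : 'm([set: coset_of <[[~ x, y]]>]) <= n.
    rewrite grank_abelian // (rank_pgroup pQ).
    by apply: leq_trans (p_rank_le_logn _ _) _; rewrite oQ pfactorK.
  pose K := ('C_[set: gT][x] :&: 'C_[set: gT][y])%G.
  have iK : #|[set: gT] : K| <= p ^ 2.
    apply: leq_trans (leq_indexI _ _) _.
    by rewrite -mulnn leq_mul // -[p]expn1 -oG' index_cent1_der1.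
  have Kz : {in K, forall g, tensor [~ x, y] g = 1}.
    move=> g /setIP[/setIP[_ /cent1P gx] /setIP[_ /cent1P gy]].
    exact: zcent.
  apply: at_mostW (at_most_central_extension zC zsym Kz
    (at_most_abelian_tensor abQ)).
  rewrite subn0 expnD leq_mul // -cardsT oQ -expnM.
  by rewrite leq_exp2l // leq_mul2l rQ orbT.
- have mn : m < n.
    by rewrite -ltnS -(leq_exp2l _ _ p_gt1) -oG -oG' subset_leq_card ?der_sub.
  case: n mn oG oQ => // n mn oG oQ.
  have iG' : #|[set: gT] : [set: gT]^`(1)| = (p ^ (n - m))%N.
    apply/eqP; rewrite -(eqn_pmul2l (cardG_gt0 [set: gT]^`(1))).
    by rewrite Lagrange ?der_sub // oG oG' -expnD !addSn subnKC.
  apply: at_mostW (at_most_central_extension (K := [set: gT]^`(1)%G)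
    zC zsym (tensor_central_der1 zC) (IHm _ _ pQ oQ oQ')).
  by rewrite iG' -expnD leq_exp2l // subSS mulSn addnC addnA.
Qed.

End Induction.

Theorem theorem2p7 (p n m : nat) (gT : finGroupType) (G : {group gT}) :
  prime p -> (p.-group G)%g -> ~~ (abelian G)%g ->
  #|G| = p ^ n -> #|(G^`(1))%g| = p ^ m ->
  ([set: tensor_square (subg_of G)]%classic
     #<= `I_(p ^ ((n - 1) * (n - m) + 2)))%card.
Proof.
move=> p_pr pG nabG oG oG'.
have imG : (sgval @* [set: subg_of G] = G)%g by exact: im_sgval.
have oT : #|[set: subg_of G]| = #|G|.
  by rewrite -[in RHS]imG card_injm ?injm_sgval.
have oT' : #|[set: subg_of G]^`(1)%g| = #|G^`(1)%g|.
  by rewrite -[in RHS]imG -morphim_der ?card_injm ?injm_sgval ?finset.subsetT.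
case: m oG' => [|m] oG'.
  by case/derG1P: nabG; apply/card1_trivg; rewrite oG'.
case: n oG => [|n] oG.
  by case/negP: nabG; rewrite (card1_trivg oG) abelian1.
have [s sk sP] :
    at_most (tensor_square (subg_of G)) (p ^ ((n.+1 - 1) * (n - m) + 2)).
  rewrite subn1; apply: at_most_tensor_square; rewrite ?oT ?oT' //.
  by rewrite /pgroup oT.
apply: (@card_le_trans _ _ _ (`I_(size s))%classic); last by rewrite card_le_II.
pose f t := index t s.
have -> :
    [set: tensor_square (subg_of G)]%classic = (f @^-1` `I_(size s))%classic.
  by apply/seteqP; split=> t //= _; rewrite /f index_mem.
apply: card_ge_preimage => t u _ _ ftu.
by rewrite -(nth_index 1%g (sP t)) -/(f t) ftu nth_index.
Qed.
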